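(* Let $n$ be an integer and let $I=\langle yz+y+z,\ n+y+z\rangle$ be the ideal of trivial charge configurations, in $\mathbb{Z}[y,z]$, of one sector of the CSS coupled wire model with $f=y+z+yz$, $g=n+y+z$. Then $\{a+bz : a,b\in\mathbb{Z}\}$ is a complete set of coset representatives for $\mathbb{Z}[y,z]/I$, i.e. every polynomial in $\mathbb{Z}[y,z]$ is congruent modulo $I$ to exactly one polynomial of the form $a+bz$ with $a,b\in\mathbb{Z}$. Likewise, $\{a+by: a,b\in\mathbb{Z}\}$ is a complete set of coset representatives for $\mathbb{Z}[y,z]/I$.
   Context: In the coupled wire model, a monomial $y^jz^k$ denotes the site $(j,k)$ in the plane transverse to the wires, a polynomial with integer coefficients denotes a configuration of integer kink charges in one sector, and the charge configurations that can be created by local operators (''trivial'' ones) are those in the ideal $I$. All charge configurations are written with non-negative exponents (by a choice of origin), so the ambient ring is the polynomial ring $\mathbb{Z}[y,z]$, not the Laurent polynomial ring. A set of coset representatives for $\mathbb{Z}[y,z]/I$ is called a charge basis. *)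

(* Defs.v *)
From mathcomp Require Import all_boot all_algebra.
From mathcomp Require Import mpoly.

Set Implicit Arguments.
Unset Strict Implicit.
Unset Printing Implicit Defensive.

Import GRing.Theory.
Local Open Scope ring_scope.

(* The ideal <f, g>; MathComp's idealr structure only covers proper ideals
   given by boolean predicates. *)
Definition ideal2 (R : comNzRingType) (f g : R) : R -> Prop :=
  fun p => exists u v : R, p = u * f + v * g.

(* S is a complete set of coset representatives for R / I: each p is congruent
   modulo I to exactly one element of S. *)
Definition coset_reps (R : comNzRingType) (I S : R -> Prop) : Prop :=
  forall p : R, exists! r : R, S r /\ I (p - r).

(* y ^+ j * z ^+ k is the site (j, k) of the plane transverse to the wires;
   exponents are natural numbers, so the ring is Z[y,z], not its Laurent
   version. *)
Definition y : {mpoly int[2]} := 'X_(0 : 'I_2).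
Definition z : {mpoly int[2]} := 'X_(1 : 'I_2).

(* One sector of the CSS coupled wire model with f = y + z + yz and
   g = n + y + z. *)
Definition trivial_charges (n : int) : {mpoly int[2]} -> Prop :=
  ideal2 (y * z + y + z) (n%:MP + y + z).

(* The set {a + b t : a, b in Z}. *)
Definition affine_in (t : {mpoly int[2]}) : {mpoly int[2]} -> Prop :=
  fun p => exists a b : int, p = a%:MP + b%:MP * t.

(* Main.v *)
(** In the quotient [y = - n - z], so [f = 0] becomes the monic quadratic relation
    [z ^+ 2 + n * z + n = 0], which reduces every polynomial to some [a + b * z].
    Conversely, substituting [- n - 'X] for [y] and ['X] for [z] sends the ideal to
    the multiples of ['X^2 + n 'X + n] in [{poly R}], and a nonzero multiple of a
    monic quadratic has degree at least two. The ideal is symmetric in [y] and [z]. *)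

Require Import Defs.
From mathcomp Require Import all_boot all_algebra.
From mathcomp Require Import mpoly ring.

Set Implicit Arguments.
Unset Strict Implicit.
Unset Printing Implicit Defensive.

Import GRing.Theory.
Local Open Scope ring_scope.

Section Ideal2.

Variables (R : comNzRingType) (f g : R).

Lemma ideal2D (p q : R) :
  ideal2 f g p -> ideal2 f g q -> ideal2 f g (p + q).
Proof.
move=> [u [v ->]] [u' [v' ->]]; exists (u + u'), (v + v'); ring.
Qed.

Lemma ideal2Ml (r p : R) : ideal2 f g p -> ideal2 f g (r * p).
Proof. by move=> [u [v ->]]; exists (r * u), (r * v); ring. Qed.

Lemma ideal2N (p : R) : ideal2 f g p -> ideal2 f g (- p).
Proof. by rewrite -mulN1r; apply: ideal2Ml. Qed.

End Ideal2.

(** A monic factor raises the size of a nonzero polynomial by its full degree, even when [R] has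
    zero divisors. *)
Lemma size_monic_quadratic_multiple (R : comNzRingType) (c d : R) (p : {poly R}) :
  (size (p * ('X^2 + c *: 'X + d%:P))%R <= 2)%N -> p = 0.
Proof.
set q := _ + _ + _.
have szq : size ('X^2 + (c *: 'X + d%:P)) = 3.
  rewrite size_polyDl size_polyXn // ltnS.
  apply: leq_trans (size_polyD _ _) _; rewrite geq_max.
  rewrite (leq_trans (size_scale_leq _ _)) ?size_polyX //.
  by rewrite (leq_trans (size_polyC_leq1 _)).
have mq : q \is monic.
  rewrite monicE lead_coefE /q -addrA szq !coefE /=.
  by rewrite mulr0 !addr0.
case: (eqVneq p 0) => // p0; rewrite size_Mmonic // /q -addrA szq.
by have := p0; rewrite -size_poly_gt0; case: (size p) => // k _; rewrite addnC.
Qed.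

Section QuadraticQuotient.

Variables (R : comNzRingType) (n : R) (i j : 'I_2).
Hypothesis neq_ij : i != j.

(** With [i] and [j] abstract, one argument serves both choices of the surviving variable [t]. *)
Let s : {mpoly R[2]} := 'X_i.
Let t : {mpoly R[2]} := 'X_j.
Let I := ideal2 (s * t + s + t) (n%:MP + s + t).
Let reducible (p : {mpoly R[2]}) := exists a b : R, I (p - (a%:MP + b%:MP * t)).

Lemma reducibleC (c : R) : reducible c%:MP.
Proof. by exists c, 0, 0, 0; rewrite mpolyC0; ring. Qed.

Lemma reducibleD (p q : {mpoly R[2]}) :
  reducible p -> reducible q -> reducible (p + q).
Proof.
move=> [a [b Ip]] [c [d Iq]]; exists (a + c), (b + d).
have := ideal2D Ip Iq; congr I; rewrite !mpolyCD; ring.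
Qed.

Lemma reducibleM (p q : {mpoly R[2]}) :
  reducible p -> reducible q -> reducible (p * q).
Proof.
move=> [a [b Ip]] [c [d Iq]].
(* Expand [(a + b t)(c + d t)] and replace [t ^+ 2] by [- n t - n]. *)
exists (a * c - b * d * n), (a * d + b * c - b * d * n).
(* Subtracting the first generator from [t + 1] times the second eliminates [s]. *)
have It : I (t ^+ 2 + n%:MP * t + n%:MP) by exists (-1), (t + 1); ring.
have := ideal2D (ideal2Ml (b * d)%:MP It)
  (ideal2D (ideal2Ml q Ip) (ideal2Ml (a%:MP + b%:MP * t) Iq)).
congr I; rewrite !(mpolyCD, mpolyCB, mpolyCN, mpolyCM); ring.
Qed.

Lemma reducibleX (k : 'I_2) : reducible 'X_k.
Proof.
have [->|->] : k = i \/ k = j.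
- case: (eqVneq k i) => [|ki]; first by left.
  right; apply/val_inj; move: neq_ij ki.
  by case: i j k => [[|[|?]] ?] [[|[|?]] ?] [[|[|?]] ?].
- exists (- n), (-1), 0, 1; rewrite !mpolyCN; rewrite -/s; ring.
- exists 0, 1, 0, 0; rewrite mpolyC0 -/t; ring.
Qed.

(** Constants and variables are reducible, and they generate the ring under sums and products. *)
Lemma reducible_all (p : {mpoly R[2]}) : reducible p.
Proof.
rewrite [p]mpolyE; elim/big_ind: _ => [||m _].
- by rewrite -mpolyC0; apply: reducibleC.
- exact: reducibleD.
rewrite -mul_mpolyC; apply: reducibleM; first exact: reducibleC.
rewrite mpolyXE_id; elim/big_ind: _ => [||k _].
- exact: reducibleC.
- exact: reducibleM.
elim: (m k) => [|e IHe]; first exact: reducibleC.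
by rewrite exprS; apply: reducibleM => //; apply: reducibleX.
Qed.

Lemma affine_ideal_eq0 (a b : R) : I (a%:MP + b%:MP * t) -> a = 0 /\ b = 0.
Proof.
pose h (k : 'I_2) : {poly R} := if k == j then 'X else - n%:P - 'X.
move=> [u [v /(congr1 (mmap polyC h))]].
rewrite !(rmorphD, rmorphM) /= !mmapC !mmapX !mmap1U /h eqxx (negPf neq_ij).
set U := mmap _ _ u => E.
(* Under [h] the second generator vanishes and the first becomes [- ('X^2 + n 'X + n)], hence the
   sign before [U]. *)
have {}E : a%:P + b%:P * 'X = - U * ('X^2 + n *: 'X + n%:P).
  by rewrite E -mul_polyC; ring.
have U0 : - U = 0.
  apply: (size_monic_quadratic_multiple (c := n) (d := n)); rewrite -E addrC.
  by rewrite size_MXaddC; case: ifP => // _; rewrite ltnS size_polyC_leq1.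
move: E; rewrite U0 mul0r => /polyP E.
by have := E 0%N; have := E 1%N; rewrite !coefE /= add0r mulr1 mulr0 addr0.
Qed.

Lemma quadratic_quotient_reps :
  coset_reps I (fun p => exists a b : R, p = a%:MP + b%:MP * t).
Proof.
move=> p; have [a [b Ip]] := reducible_all p.
exists (a%:MP + b%:MP * t); split; first by split; first by exists a, b.
move=> _ [[c [d ->]] Ip'].
(* The difference of two representatives of [p] is an affine element of the ideal. *)
have [] := @affine_ideal_eq0 (a - c) (b - d).
  have := ideal2D Ip' (ideal2N Ip); congr I.
  rewrite !mpolyCB; ring.
by move=> /subr0_eq -> /subr0_eq ->.
Qed.

End QuadraticQuotient.

Theorem mainTheorem2 (n : int) :
  coset_reps (trivial_charges n) (affine_in z) /\
  coset_reps (trivial_charges n) (affine_in y).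
Proof.
split; first exact: quadratic_quotient_reps.
(* Exchanging [y] and [z] in the generators gives the instance where [t] is [y]. *)
have -> : trivial_charges n = ideal2 (z * y + z + y) (n%:MP + z + y).
  by rewrite /trivial_charges mulrC -!addrA [z + y]addrC.
exact: quadratic_quotient_reps.
Qed.
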